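(* For every $0<\delta<1$ there exist $\eta=\eta(\delta)>0$ and $\omega=\omega(\delta)>1$ such that the following holds. Let $n$ and $m$ be integers with $2\le m\le n$ and $n\ge \omega m$. Then $P_m(Z)\neq 0$ for every $n\times n$ symmetric complex matrix $Z=(z_{ij})$ such that $$|\operatorname{Re} z_{ij}|\le \frac{\delta}{m-1}\quad\text{and}\quad |\operatorname{Im} z_{ij}|\le \frac{\eta}{m-1}\quad\text{for all } 1\le i\ne j\le n,$$ where $$P_m(Z)=\sum_{S\subset\{1,\dots,n\},\ |S|=m}\exp\Big\{\sum_{\{i,j\}\subset S,\ i\ne j} z_{ij}\Big\},$$ the inner sum being over unordered pairs of distinct elements of $S$.
   Context: The diagonal entries of $Z$ do not enter $P_m(Z)$. *)

(* Defs.v *)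
From HB Require Import structures.
From mathcomp Require Import all_boot all_order all_algebra.
From mathcomp Require Import complex.
From mathcomp Require Import reals sequences exp trigo.

Set Implicit Arguments.
Unset Strict Implicit.
Unset Printing Implicit Defensive.

Import Order.TTheory GRing.Theory Num.Theory.

Local Open Scope ring_scope.
Local Open Scope complex_scope.

(* MathComp-Analysis has no complex exponential, so it is given here by
   exp(x + iy) = e^x (cos y + i sin y). *)
Definition expC (R : realType) (z : R[i]) : R[i] :=
  (expR (complex.Re z))%:C * (cos (complex.Im z) +i* sin (complex.Im z)).

(* An unordered pair {i, j} of distinct elements of S is represented by its
   unique ordering with i < j. For a symmetric Z this choice is immaterial. *)
Definition pair_sum (R : realType) (n : nat) (Z : 'M[R[i]]_n)
    (S : {set 'I_n}) : R[i] :=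
  \sum_(i in S) \sum_(j in S | (i < j)%N) Z i j.

Definition Pm (R : realType) (n m : nat) (Z : 'M[R[i]]_n) : R[i] :=
  \sum_(S : {set 'I_n} | #|S| == m) expC (pair_sum Z S).

(* Main.v *)
(** Let [P_O] be the sum of the terms of [P_m] over the sets [S] containing [O];
    then [(m - |O|) P_O] is the sum of the [P_{O+k}] over [k] outside [O].  By
    descending induction on [|O|] one shows that the numbers [P_{O+k}], for a
    fixed [O], pairwise make an angle with tangent at most [tau] and have
    comparable moduli; their sum is then nonzero, so [P_O <> 0].

    To compare [P_{O+i}] with [P_{O+j}], move [Z] linearly to the matrix in which
    [i] and [j] are exchanged.  The derivative of [P_{O+i}] along this segment is
    the sum over [k] of [(z_jk - z_ik) (P_{O+i+k} - P_{O+i+j+k})].  The terms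
    [P_{O+i+j+k}] are negligible because [n / m] is large.  As for the
    [P_{O+i+k}], their components orthogonal to [P_{O+i}] add up to zero, so that
    their absolute values add up to at most [(tau / 2) (m - 1) |P_{O+i}|]; since
    [|Re (z_jk - z_ik)| <= 2 delta / (m - 1)], the argument of [P_{O+i}] turns by
    at most [delta tau] up to small terms, which is less than [atan tau] for
    small [tau]. *)

Require Import Defs.
From mathcomp Require Import boolp classical_sets reals topology normedtype.
From mathcomp Require Import sequences derive realfun exp trigo.
From mathcomp Require Import all_boot all_order all_algebra perm.
From mathcomp Require Import complex.
From mathcomp Require Import ring lra zify.

Set Implicit Arguments.
Unset Strict Implicit.
Unset Printing Implicit Defensive.

Import Order.TTheory GRing.Theory Num.Theory.
Import numFieldNormedType.Exports.

Local Open Scope ring_scope.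


(** * Real analysis: turning angle and growth of a plane curve *)

Lemma continuous_pos_nbhs (R : realType) (h : R -> R) (s : R) :
  {for s, continuous h} -> 0 < h s ->
  exists2 e : R, 0 < e & forall t, `|t - s| < e -> 0 < h t.
Proof.
move=> hc hs.
have /nbhs_ballP[e e0 he] : nbhs s [set t | 0 < h t]%classic.
  exact: (cvgr_gt _ hc).
by exists e => // t ht; apply: he; rewrite /ball/= distrC.
Qed.

(** The infimum of the times [t >= 0] with [x t <= 0] works: if [x] were positive there, it would be
    so nearby, and no such times could approach the infimum. *)
Lemma first_nonpos (R : realType) (x : R -> R) (t1 : R) :
  continuous x -> 0 < x 0 -> 0 <= t1 -> x t1 <= 0 ->
  exists s, [/\ 0 < s <= t1, x s <= 0 & forall t : R, 0 <= t < s -> 0 < x t].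
Proof.
move=> xc x0 t10 xt1.
pose A := [set t | 0 <= t /\ x t <= 0]%classic.
have At1 : A t1 by [].
have Alb : has_lbound A by exists 0 => t [].
have Ainf : has_inf A by split=> //; exists t1.
have s0 : 0 <= inf A by apply: lb_le_inf; [exists t1|move=> t []].
have xs : x (inf A) <= 0.
  rewrite leNgt; apply/negP => xs.
  have [e e0 he] := continuous_pos_nbhs (xc _) xs.
  have [t [t0 xt] te] := inf_adherent e0 Ainf.
  have st : inf A <= t by exact: ge_inf.
  have := he t; rewrite ger0_norm ?subr_ge0// ltrBlDl te => /(_ isT).
  by rewrite ltNge xt.
exists (inf A); split=> //.
- rewrite (ge_inf Alb At1) andbT lt_neqAle s0 andbT.
  by apply/eqP => s00; move: xs; rewrite -s00 leNgt x0.
- move=> t /andP[t0 ts]; rewrite ltNge; apply/negP => xt.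
  by have := ge_inf Alb (conj t0 xt : A t); rewrite leNgt ts.
Qed.

Lemma continuous_ge0_left_end (R : realType) (h : R -> R) (s : R) :
  {for s, continuous h} -> 0 < s -> (forall t : R, 0 <= t < s -> 0 <= h t) ->
  0 <= h s.
Proof.
move=> hc s0 h0; rewrite leNgt; apply/negP => hs.
have hNc : {for s, continuous (fun t => - h t)} by exact: cvgN.
have [||e e0 he] := @continuous_pos_nbhs R (fun t => - h t) s => //.
  by rewrite oppr_gt0.
pose t := Num.max 0 (s - e / 2).
have ts : t < s by rewrite gt_max s0/= gtrBl divr_gt0.
have t0 : 0 <= t by rewrite le_max lexx.
have st : s - e / 2 <= t by rewrite le_max lexx orbT.
have := he t; rewrite oppr_gt0 ltr0_norm ?subr_lt0// opprB => ht.
have := h0 t; rewrite t0 ts leNgt ht => [/(_ isT)//|].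
by rewrite ltrBlDl; apply: (@lt_le_trans _ _ (s - e / 2 + e)); lra.
Qed.

Lemma MVT_everywhere (R : realType) (f df : R -> R) (s : R) : 0 <= s ->
  (forall t : R, 0 <= t <= s -> is_derive t 1 f (df t)) ->
  exists2 c, 0 <= c <= s & f s - f 0 = df c * s.
Proof.
move=> s0 fd.
have [t|t|c /itvP cI E] := @MVT_segment R f df 0 s s0.
- by move=> /itvP tI; apply: fd; rewrite !tI.
- have ft u : u \in `[0, s] -> derivable f u 1.
    by move=> /itvP uI; have := fd u; rewrite !uI => /(_ isT) [].
  by apply: derivable_within_continuous.
- by exists c; rewrite ?cI// E subr0.
Qed.

(** The derivative of [atan] on [[0, x]] is at least its value at [x]. This gives an explicit lower
    bound for the allowed turning [atan tau]. *)
Lemma atan_ge_div (R : realType) (x : R) : 0 <= x ->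
  x / (1 + x ^+ 2) <= atan x.
Proof.
move=> x0.
have [c /andP[c0 cx] E] := MVT_everywhere x0 (fun t _ => is_derive1_atan t).
rewrite -[atan x]subr0 -(atan0 R) E mulrC ler_wpM2r//.
by rewrite lef_pV2 ?posrE ?ltr_wpDr ?sqr_ge0// lerD2l ler_sqr ?nnegrE.
Qed.

(* With [q = y / x], the hypothesis says that [atan q] has derivative at most
   [atan tau] in absolute value. *)
Lemma slope_bound (R : realType) (x y dx dy : R -> R) (tau s : R) :
  (forall t : R, is_derive t 1 x (dx t)) ->
  (forall t : R, is_derive t 1 y (dy t)) ->
  0 <= s <= 1 -> 0 <= tau ->
  y 0 = 0 ->
  (forall t : R, 0 <= t <= s -> 0 < x t) ->
  (forall t : R, 0 <= t <= s ->
     `|x t * dy t - y t * dx t| <= atan tau * (x t ^+ 2 + y t ^+ 2)) ->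
  `|y s| <= tau * x s.
Proof.
move=> xd yd /andP[s0 s1] tau0 y0 xp hb.
pose w t := (x t * dy t - y t * dx t) / (x t ^+ 2 + y t ^+ 2).
have qd t : 0 <= t <= s -> is_derive t 1 (fun u => atan (y u / x u)) (w t).
  move=> /xp xt.
  have xt0 : x t != 0 by rewrite gt_eqF.
  have D : is_derive t 1 (fun u => y u / x u)
      ((x t * dy t - y t * dx t) / x t ^+ 2).
    apply: (is_derive_eq (is_deriveM (yd t) (is_deriveV xt0 (xd t)))).
    by rewrite /GRing.scale/=; field.
  apply: (is_derive_eq (is_derive1_comp (is_derive1_atan _) D)).
  have ? : x t ^+ 2 + y t ^+ 2 != 0.
    by rewrite gt_eqF// ltr_pwDl ?exprn_gt0// sqr_ge0.
  by rewrite /w; field; apply/andP; split.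
have [c cs E] := MVT_everywhere s0 qd.
have {}E : atan (y s / x s) = w c * s by rewrite -E y0 mul0r atan0 subr0.
have dc : 0 < x c ^+ 2 + y c ^+ 2.
  by rewrite ltr_pwDl ?exprn_gt0 ?xp// sqr_ge0.
have wc : `|w c| <= atan tau.
  by rewrite /w normrM normfV (gtr0_norm dc) ler_pdivrMr// hb.
have : `|w c * s| <= atan tau.
  rewrite normrM (ger0_norm s0) -[leRHS]mulr1.
  by apply: ler_pM.
rewrite -E ler_norml -atanN => /andP[lo hi].
have xs : 0 < x s by apply: xp; rewrite s0 lexx.
rewrite ler_norml -mulNr.
have atan_le (u v : R) : atan u <= atan v -> u <= v.
  move=> uv; rewrite leNgt; apply/negP => vu.
  suff : atan v < atan u by rewrite ltNge uv.
  exact: lt_atan.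
apply/andP.
by split; [rewrite -ler_pdivlMr//|rewrite -ler_pdivrMr//]; exact: atan_le.
Qed.

(** Taking the initial vector as first axis reduces this to [slope_bound], with [x] and [y] the dot
    and cross products with that vector. What remains is to show that [x] stays positive. *)
Lemma angle_bound (R : realType) (a b da db : R -> R) (tau : R) :
  (forall t : R, is_derive t 1 a (da t)) ->
  (forall t : R, is_derive t 1 b (db t)) -> 0 <= tau ->
  (forall t : R, 0 <= t <= 1 -> 0 < a t ^+ 2 + b t ^+ 2) ->
  (forall t : R, 0 <= t <= 1 ->
     `|a t * db t - b t * da t| <= atan tau * (a t ^+ 2 + b t ^+ 2)) ->
  `|a 0 * b 1 - b 0 * a 1| <= tau * (a 0 * a 1 + b 0 * b 1).
Proof.
move=> ad bd tau0 gp hb.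
have derC (k : R) (f df : R -> R) :
    (forall t : R, is_derive t 1 f (df t)) ->
    forall t : R, is_derive t 1 (fun t => k * f t) (k * df t).
  by move=> fd t; have := is_deriveZ k (fd t).
pose x t := a 0 * a t + b 0 * b t.
pose y t := a 0 * b t - b 0 * a t.
have xd (t : R) : is_derive t 1 x (a 0 * da t + b 0 * db t).
  by apply: is_deriveD; exact: derC.
have yd (t : R) : is_derive t 1 y (a 0 * db t - b 0 * da t).
  by apply: is_deriveB; exact: derC.
have cont (f df : R -> R) :
    (forall t : R, is_derive t 1 f (df t)) -> continuous f.
  move=> fd t; apply: differentiable_continuous; apply/derivable1_diffP.
  by case: (fd t).
have g0 : 0 < a 0 ^+ 2 + b 0 ^+ 2 by apply: gp; rewrite lexx ler01.
have y0 : y 0 = 0 by rewrite /y; ring.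
have x0 : 0 < x 0 by rewrite /x -!expr2.
have nE t : x t ^+ 2 + y t ^+ 2 =
    (a 0 ^+ 2 + b 0 ^+ 2) * (a t ^+ 2 + b t ^+ 2) by rewrite /x /y; ring.
have hb' t : 0 <= t <= 1 ->
    `|x t * (a 0 * db t - b 0 * da t) - y t * (a 0 * da t + b 0 * db t)|
      <= atan tau * (x t ^+ 2 + y t ^+ 2).
  move=> t01; rewrite nE.
  have -> : x t * (a 0 * db t - b 0 * da t) - y t * (a 0 * da t + b 0 * db t) =
     (a 0 ^+ 2 + b 0 ^+ 2) * (a t * db t - b t * da t) by rewrite /x /y; ring.
  by rewrite normrM gtr0_norm// mulrCA ler_pM2l// hb.
(* At a first time [s] with [x s <= 0], the slope bound, valid on [[0, s)], passes to the limit and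
   forces [x s = y s = 0], although the curve avoids the origin. *)
have xp t : 0 <= t <= 1 -> 0 < x t.
  move=> /andP[t0 t1]; rewrite ltNge; apply/negP => xt.
  have [s [/andP[s0 st] xs xlt]] := first_nonpos (cont _ _ xd) x0 t0 xt.
  have s1 : s <= 1 by exact: le_trans st t1.
  have slope u : 0 <= u < s -> `|y u| <= tau * x u.
    move=> /andP[u0 us].
    have uv v : 0 <= v <= u -> 0 <= v < s.
      by move=> /andP[-> /le_lt_trans->].
    apply: (slope_bound xd yd) => //.
    - by rewrite u0 (le_trans (ltW us)).
    - by move=> v /uv; exact: xlt.
    - move=> v /uv/andP[v0 vs]; apply: hb'.
      by rewrite v0 (le_trans (ltW vs)).
  (* Used with [e = -1] and [e = 1], the two halves of [|y| <= tau * x]. *)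
  have end_ge0 (e : R) :
      (forall u : R, 0 <= u < s -> 0 <= tau * x u + e * y u) ->
      0 <= tau * x s + e * y s.
    apply: (@continuous_ge0_left_end _ (fun u => tau * x u + e * y u)) => //.
    have hd (u : R) : is_derive u 1 (fun u => tau * x u + e * y u)
        (tau * (a 0 * da u + b 0 * db u) + e * (a 0 * db u - b 0 * da u)).
      by apply: is_deriveD; exact: derC.
    exact: cont hd s.
  have taux : tau * x s <= 0 by rewrite mulr_ge0_le0.
  have s01 : 0 <= s <= 1 by rewrite (ltW s0).
  have xy : 0 < x s ^+ 2 + y s ^+ 2 by rewrite nE mulr_gt0// gp.
  have k1 : 0 <= tau * x s - y s.
    rewrite -mulN1r; apply: end_ge0 => u /slope; rewrite mulN1r ler_norml.
    by move=> /andP[_]; rewrite subr_ge0.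
  have k2 : 0 <= tau * x s + y s.
    rewrite -[y s]mul1r; apply: end_ge0 => u /slope; rewrite mul1r ler_norml.
    by move=> /andP[+ _]; rewrite addrC -subr_ge0 opprK.
  have ys : y s = 0 by apply/eqP; rewrite eq_le; apply/andP; split; lra.
  have xs0 : x s = 0.
    apply/eqP; rewrite eq_le xs/=.
    by apply: (continuous_ge0_left_end (cont _ _ xd s) s0) => u /xlt/ltW.
  by move: xy; rewrite ys xs0 expr0n/= addr0 ltxx.
by apply: (slope_bound xd yd) => //; rewrite ler01 lexx.
Qed.

(** Gronwall's argument: the squared modulus times [expR (- (2 * C) * t)] has nonpositive derivative
    on [[0, 1]]. *)
Lemma modulus_growth (R : realType) (a b da db : R -> R) (C : R) :
  (forall t : R, is_derive t 1 a (da t)) ->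
  (forall t : R, is_derive t 1 b (db t)) ->
  (forall t : R, 0 <= t <= 1 ->
     `|a t * da t + b t * db t| <= C * (a t ^+ 2 + b t ^+ 2)) ->
  a 1 * a 1 + b 1 * b 1 <= expR (2 * C) * (a 0 * a 0 + b 0 * b 0).
Proof.
move=> ad bd hC.
pose f (t : R) := expR (- (2 * C) * t) * (a t * a t + b t * b t).
pose df (t : R) := 2 * expR (- (2 * C) * t) *
   (a t * da t + b t * db t - C * (a t ^+ 2 + b t ^+ 2)).
have fd (t : R) : 0 <= t <= 1 -> is_derive t 1 f (df t).
  move=> _.
  have ed : is_derive t 1 (fun t : R => expR (- (2 * C) * t))
      (expR (- (2 * C) * t) * (- (2 * C))).
    apply: is_derive1_comp.
    apply: (is_derive_eq (is_deriveZ (- (2 * C)) (is_derive_id t (1 : R)))).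
    by rewrite /GRing.scale/= mulr1.
  have D : is_derive t 1 (fun t => a t * a t + b t * b t)
      (2 * (a t * da t + b t * db t)).
    apply: (is_derive_eq (is_deriveD (is_deriveM (ad t) (ad t))
                                     (is_deriveM (bd t) (bd t)))).
    by rewrite /GRing.scale/=; ring.
  apply: (is_derive_eq (is_deriveM ed D)).
  by rewrite /df /GRing.scale/=; ring.
have [c c01] := MVT_everywhere ler01 fd.
rewrite mulr1 => E.
have : f 1 <= f 0.
  rewrite -subr_le0 E /df mulr_ge0_le0 ?mulr_ge0 ?expR_ge0//.
  by rewrite subr_le0 (le_trans (ler_norm _))// hC.
rewrite /f mulr0 expR0 mul1r mulr1 expRN.
by rewrite ler_pdivrMl ?expR_gt0.
Qed.


(** * Dot and cross products in the complex plane *)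

Section ComplexPlane.
Variable R : realType.
Implicit Types (u v w : R[i]) (t : R).

Local Notation Re := (@complex.Re R).
Local Notation Im := (@complex.Im R).

(** [cdot] and [ccross] are the real and imaginary parts of the conjugate of [u] times [v]. For
    nonzero vectors, [|ccross u v| <= tau * cdot u v] says that their angle has tangent at most
    [tau]. *)
Definition cdot u v : R := Re u * Re v + Im u * Im v.
Definition ccross u v : R := Re u * Im v - Im u * Re v.

Lemma cReD u v : Re (u + v) = Re u + Re v. Proof. by case: u; case: v. Qed.
Lemma cImD u v : Im (u + v) = Im u + Im v. Proof. by case: u; case: v. Qed.
Lemma cReN u : Re (- u) = - Re u. Proof. by case: u. Qed.
Lemma cImN u : Im (- u) = - Im u. Proof. by case: u. Qed.
Lemma cReM u v : Re (u * v) = Re u * Re v - Im u * Im v.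
Proof. by case: u; case: v. Qed.
Lemma cImM u v : Im (u * v) = Re u * Im v + Im u * Re v.
Proof. by case: u; case: v. Qed.
Definition cReImE := (cReD, cImD, cReN, cImN, cReM, cImM).

Lemma cRe_sum (I : Type) (r : seq I) (P : pred I) (F : I -> R[i]) :
  Re (\sum_(i <- r | P i) F i) = \sum_(i <- r | P i) Re (F i).
Proof. exact: (big_morph Re cReD (erefl _)). Qed.

Lemma cIm_sum (I : Type) (r : seq I) (P : pred I) (F : I -> R[i]) :
  Im (\sum_(i <- r | P i) F i) = \sum_(i <- r | P i) Im (F i).
Proof. exact: (big_morph Im cImD (erefl _)). Qed.

Lemma cdot_sumr (I : Type) (r : seq I) (P : pred I) (F : I -> R[i]) u :
  cdot u (\sum_(i <- r | P i) F i) = \sum_(i <- r | P i) cdot u (F i).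
Proof. by rewrite /cdot cRe_sum cIm_sum !mulr_sumr -big_split. Qed.

Lemma ccross_sumr (I : Type) (r : seq I) (P : pred I) (F : I -> R[i]) u :
  ccross u (\sum_(i <- r | P i) F i) = \sum_(i <- r | P i) ccross u (F i).
Proof. by rewrite /ccross cRe_sum cIm_sum !mulr_sumr -sumrB. Qed.

Lemma ccrossvv u : ccross u u = 0. Proof. by rewrite /ccross; ring. Qed.

Lemma cdotvv_ge0 u : 0 <= cdot u u.
Proof. by rewrite addr_ge0// -expr2 sqr_ge0. Qed.

Lemma cdotvv_eq0 u : (cdot u u == 0) = (u == 0).
Proof.
rewrite /cdot -!expr2 paddr_eq0 ?sqr_ge0// !sqrf_eq0.
by case: u => a b; rewrite eq_complex.
Qed.

Lemma cdotvv_gt0 u : (0 < cdot u u) = (u != 0).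
Proof. by rewrite lt_neqAle cdotvv_ge0 andbT eq_sym cdotvv_eq0. Qed.

(** Real coefficients do not rotate [w k], so the larger bound [a] meets only the components
    orthogonal to [p]; the parallel ones are multiplied by the bound [b] on imaginary parts. *)
Lemma weighted_ccross_le (I : finType) (A : pred I) (d w : I -> R[i]) (a b : R)
    (p : R[i]) :
  (forall k, A k -> `|Re (d k)| <= a) -> (forall k, A k -> `|Im (d k)| <= b) ->
  `|ccross p (\sum_(k | A k) d k * w k)| <=
    a * (\sum_(k | A k) `|ccross p (w k)|) +
    b * (\sum_(k | A k) `|cdot p (w k)|).
Proof.
move=> ha hb; rewrite ccross_sumr !mulr_sumr -big_split/=.
apply: le_trans (ler_norm_sum _ _ _) _; apply: ler_sum => k Ak.
have -> : ccross p (d k * w k) =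
    Re (d k) * ccross p (w k) + Im (d k) * cdot p (w k).
  by rewrite /ccross /cdot !cReImE; ring.
apply: le_trans (ler_normD _ _) _; rewrite !normrM.
by rewrite lerD// ler_wpM2r// ?ha ?hb.
Qed.

Lemma weighted_cdot_le (I : finType) (A : pred I) (d w : I -> R[i]) (a b : R)
    (p : R[i]) :
  (forall k, A k -> `|Re (d k)| <= a) -> (forall k, A k -> `|Im (d k)| <= b) ->
  `|cdot p (\sum_(k | A k) d k * w k)| <=
    a * (\sum_(k | A k) `|cdot p (w k)|) +
    b * (\sum_(k | A k) `|ccross p (w k)|).
Proof.
move=> ha hb; rewrite cdot_sumr !mulr_sumr -big_split/=.
apply: le_trans (ler_norm_sum _ _ _) _; apply: ler_sum => k Ak.
have -> : cdot p (d k * w k) =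
    Re (d k) * cdot p (w k) - Im (d k) * ccross p (w k).
  by rewrite /ccross /cdot !cReImE; ring.
apply: le_trans (ler_normB _ _) _; rewrite !normrM.
by rewrite lerD// ler_wpM2r// ?ha ?hb.
Qed.

(* Only half of [\sum x] is available to each sign of [y], whence the factor
   [1/2] which makes the induction close for all [delta < 1]. *)
Lemma balanced_cone (I : finType) (A : pred I) (x y : I -> R) (tau : R) :
  0 <= tau ->
  (forall k l, A k -> A l ->
     `|x k * y l - y k * x l| <= tau * (x k * x l + y k * y l)) ->
  (forall k, A k -> `|y k| <= tau * x k) ->
  \sum_(k | A k) y k = 0 ->
  2 * \sum_(k | A k) `|y k| <= tau * \sum_(k | A k) x k.
Proof.
move=> tau0 hxy hy y0.
pose pos k := 0 <= y k.
set a := \sum_(k | A k && pos k) x k; set b := \sum_(k | A k && ~~ pos k) x k.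
set h := \sum_(k | A k && pos k) y k; set h' := \sum_(k | A k && ~~ pos k) y k.
have h'E : h' = - h.
  by apply/eqP; rewrite -addr_eq0 addrC -(bigID pos) y0.
have xE : \sum_(k | A k) x k = a + b by rewrite (bigID pos).
have yE : \sum_(k | A k) `|y k| = 2 * h.
  rewrite (bigID pos)/= (eq_bigr y) => [|k /andP[_]]; last exact: ger0_norm.
  rewrite [X in _ + X](eq_bigr (fun k => - y k)) => [|k /andP[_]].
    by rewrite sumrN -/h -/h' h'E; ring.
  by rewrite -ltNge; exact: ltr0_norm.
(* Sum the pairwise hypothesis over all [k] with [y k >= 0] and all [l] with [y l < 0]. *)
have hS : h * (a + b) <= tau * (a * b - h ^+ 2).
  have -> : h * (a + b) = - (a * h' - h * b) by rewrite h'E; ring.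
  have -> : a * b - h ^+ 2 = a * b + h * h' by rewrite h'E; ring.
  rewrite !mulr_suml -sumrB -big_split/= mulr_sumr -sumrN.
  apply: ler_sum => k /andP[Ak _].
  rewrite !mulr_sumr -sumrB -big_split/= mulr_sumr -sumrN.
  apply: ler_sum => l /andP[Al _].
  have := hxy k l Ak Al; rewrite ler_norml => /andP[+ _].
  by rewrite lerNl.
have hy_le : \sum_(k | A k) `|y k| <= tau * \sum_(k | A k) x k.
  by rewrite mulr_sumr; apply: ler_sum.
rewrite yE xE in hy_le *.
have h0 : 0 <= h by apply: sumr_ge0 => k /andP[].
have [S0|S0] := ltP 0 (a + b); last first.
  have : tau * (a + b) <= 0 by rewrite mulr_ge0_le0.
  by lra.
rewrite -(ler_pM2r S0).
(* Since [4ab <= (a + b)^2], the bound [hS] gives [4h <= tau (a + b)], and [4h] is twice the sum of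
   the [|y k|]. *)
have : 0 <= tau * (a - b) ^+ 2 by rewrite mulr_ge0// sqr_ge0.
have : 0 <= tau * h ^+ 2 by rewrite mulr_ge0// sqr_ge0.
by nra.
Qed.

End ComplexPlane.


(** * Sums over pairs of indices *)

Section PairSum.
Variables (R : realType) (n : nat).
Implicit Types (Z D : 'M[R[i]]_n) (S T : {set 'I_n}) (i j k : 'I_n).

(** Each pair is counted in both orders. Free of the ordering of indices, this double of [pair_sum]
    is easier to split and to permute. *)
Definition offdiag_sum Z S : R[i] :=
  \sum_(i in S) \sum_(j in S | j != i) Z i j.

Lemma offdiag_sumE Z S : Z^T = Z -> offdiag_sum Z S = pair_sum Z S *+ 2.
Proof.
move=> ZT; rewrite mulr2n {1}/pair_sum.
rewrite [X in _ = X + _](eq_bigr (fun i : 'I_n =>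
  \sum_(j | (j \in S) && (i < j)%N) Z j i)); last first.
  by move=> i _; apply: eq_bigr => j _; rewrite -[in LHS]ZT mxE.
rewrite (exchange_big_dep (mem S)) /=; last by move=> i j _ /andP[].
rewrite -big_split/=; apply: eq_bigr => i iS.
rewrite (bigID (fun j : 'I_n => (j < i)%N)) /=; congr (_ + _).
  apply: eq_bigl => j; rewrite iS/= -andbA; congr (_ && _).
  by case: ltngtP => h; rewrite ?andbF// -(inj_eq val_inj)/= neq_ltn h.
apply: eq_bigl => j; rewrite -andbA -leqNgt; congr (_ && _).
by rewrite -(inj_eq val_inj)/= ltn_neqAle eq_sym.
Qed.

Lemma mulr2n_inj (u v : R[i]) : u *+ 2 = v *+ 2 -> u = v.
Proof.
by move=> /eqP; rewrite -subr_eq0 -mulrnBl mulrn_eq0/= subr_eq0 => /eqP.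
Qed.

Lemma pair_sumU1 Z T i : Z^T = Z -> i \notin T ->
  pair_sum Z (i |: T) = pair_sum Z T + \sum_(k in T) Z i k.
Proof.
move=> ZT iT; apply: mulr2n_inj; rewrite mulrnDl -!offdiag_sumE//.
have symZ a b : Z a b = Z b a by rewrite -[in LHS]ZT mxE.
rewrite /offdiag_sum big_setU1//= mulr2n addrCA.
have -> : \sum_(j in i |: T | j != i) Z i j = \sum_(k in T) Z i k.
  apply: eq_bigl => j; rewrite !inE.
  case: eqVneq => [->|]/=; last by rewrite andbT.
  by rewrite (negbTE iT).
congr (_ + _); rewrite addrC -big_split/=; apply: eq_bigr => a aT.
have ai : i != a by apply: contraNneq iT => ->.
rewrite (bigD1 i)/=; last by rewrite !inE eqxx.
rewrite symZ; congr (_ + _); apply: eq_bigl => j; rewrite !inE.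
by case: eqVneq => [->|]/=; rewrite ?andbT// (negbTE iT) andbF.
Qed.

Lemma pair_sum_eq0 Z T :
  (forall a b, a \in T -> b \in T -> a != b -> Z a b = 0) ->
  pair_sum Z T = 0.
Proof.
move=> Z0; apply: big1 => a aT; apply: big1 => b /andP[bT ab].
by apply: Z0 => //; rewrite -(inj_eq val_inj) ltn_eqF.
Qed.

Lemma pair_sum_perm Z S (s : 'S_n) : Z^T = Z ->
  pair_sum (\matrix_(a, b) Z (s a) (s b)) S = pair_sum Z (s @: S).
Proof.
move=> ZT; apply: mulr2n_inj; rewrite -!offdiag_sumE//; last first.
  by apply/matrixP => a b; rewrite !mxE -[in LHS]ZT mxE.
rewrite /offdiag_sum big_imset/=; last by move=> ? ? _ _; exact: perm_inj.
apply: eq_bigr => a aS; rewrite [RHS]big_mkcondr/= big_imset/=; last first.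
  by move=> ? ? _ _; exact: perm_inj.
rewrite -big_mkcondr; apply: eq_big => b; first by rewrite (inj_eq perm_inj).
by rewrite mxE.
Qed.

Lemma pair_sumD Z D S (t : R[i]) :
  pair_sum (Z + t *: D) S = pair_sum Z S + t * pair_sum D S.
Proof.
rewrite /pair_sum mulr_sumr -big_split/=; apply: eq_bigr => a _.
rewrite mulr_sumr -big_split/=; apply: eq_bigr => b _; by rewrite !mxE.
Qed.

End PairSum.

(** * The sums [P_O] over the sets containing [O] *)

Section PartialSums.
Variables (R : realType) (n m : nat).
Implicit Types (Z D : 'M[R[i]]_n) (S T O : {set 'I_n}) (i j k : 'I_n).

Definition Pext Z O : R[i] :=
  \sum_(S : {set 'I_n} | (#|S| == m) && (O \subset S)) expC (pair_sum Z S).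

Lemma Pext0 Z : Pext Z set0 = Pm m Z.
Proof. by apply: eq_bigl => S; rewrite sub0set andbT. Qed.

Lemma expC_neq0 (z : R[i]) : expC z != 0.
Proof.
rewrite /expC mulf_neq0//.
  by rewrite -(rmorph0 (real_complex R)) (inj_eq (@complexI R)) gt_eqF// expR_gt0.
rewrite eq_complex/=; apply/negP => /andP[/eqP c0 /eqP s0].
have := cos2Dsin2 (complex.Im z); rewrite c0 s0 expr0n/= addr0 => /eqP.
by rewrite eq_sym oner_eq0.
Qed.

Lemma Pext_card_gt Z O : (m < #|O|)%N -> Pext Z O = 0.
Proof.
move=> mO; apply: big_pred0 => S; apply/negbTE/negP.
move=> /andP[/eqP Sm /subset_leq_card].
by rewrite Sm leqNgt mO.
Qed.

Lemma Pext_card_eq Z O : #|O| = m -> Pext Z O = expC (pair_sum Z O).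
Proof.
move=> Om; rewrite /Pext (big_pred1 O)// => S /=.
apply/andP/eqP => [[/eqP Sm OS]|->]; last by rewrite Om eqxx subxx.
by apply/esym/eqP; rewrite eqEcard OS Om Sm/=.
Qed.

(** Each [m]-set [S] containing [O] is counted once for every element of [S] outside [O]. *)
Lemma Pext_children Z O :
  \sum_(k | k \notin O) Pext Z (k |: O) = (m - #|O|)%:R * Pext Z O.
Proof.
rewrite /Pext (exchange_big_dep (fun S => (#|S| == m) && (O \subset S)))/=;
  last first.
  by move=> k S _ /andP[-> kOS]; rewrite (subset_trans _ kOS) ?subsetUr.
rewrite mulr_sumr; apply: eq_bigr => S /andP[/eqP Sm OS].
rewrite sumr_const mulr_natl; congr (_ *+ _).
rewrite -Sm -(setIidPr OS) -cardsD; apply: eq_card => k; rewrite [RHS]inE.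
by rewrite unfold_in (setIidPr OS) eqxx subUset sub1set OS andbT.
Qed.

(** Reindex the sets [S] by the transposition, which fixes [O]. Thus [P_{O+i}] and [P_{O+j}] become
    values of one function at two matrices. *)
Lemma Pext_perm Z i j O : Z^T = Z -> i \notin O -> j \notin O ->
  Pext (\matrix_(a, b) Z (tperm i j a) (tperm i j b)) (i |: O) =
  Pext Z (j |: O).
Proof.
move=> ZT iO jO; rewrite /Pext.
have sK : involutive (fun S : {set 'I_n} => tperm i j @: S).
  move=> S; rewrite -imset_comp -[RHS]imset_id; apply: eq_imset => a /=.
  by rewrite tpermK.
rewrite [RHS](reindex_inj (inv_inj sK))/=; apply: eq_big => S; last first.
  by rewrite pair_sum_perm.
rewrite card_imset; last exact: perm_inj.
congr (_ && _).
have -> : j |: O = tperm i j @: (i |: O).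
  rewrite imsetU1 tpermL; congr (_ |: _).
  rewrite -[LHS]imset_id; apply: eq_in_imset => a aO /=.
  by rewrite tpermD//; [apply: contraNneq iO => ->|apply: contraNneq jO => ->].
by apply/idP/idP => [/imsetS->//|/(imsetS (tperm i j))]; rewrite !sK.
Qed.

End PartialSums.


(** * Derivatives along the segment to the swapped matrix *)

Lemma is_derive_bigsum (R : realType) (I : Type) (r : seq I) (P : pred I)
    (f : I -> R -> R) (df : I -> R) (t : R) :
  (forall i, P i -> is_derive t 1 (f i) (df i)) ->
  is_derive t 1 (fun u => \sum_(i <- r | P i) f i u) (\sum_(i <- r | P i) df i).
Proof.
move=> fd; elim: r => [|i r IH].
  rewrite big_nil; under eq_fun do rewrite big_nil.
  exact: is_derive_cst.
rewrite big_cons; under eq_fun do rewrite big_cons.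
by case: ifP => // Pi; apply: is_deriveD => //; exact: fd.
Qed.

Section Path.
Variables (R : realType) (n m : nat).
Implicit Types (Z D : 'M[R[i]]_n) (S T O : {set 'I_n}) (i j k : 'I_n).

Local Notation Re := (@complex.Re R).
Local Notation Im := (@complex.Im R).

Definition segment_mx Z D (t : R) : 'M[R[i]]_n := Z + (real_complex R t) *: D.

(** Real and imaginary parts are differentiated separately, so that only derivatives of real
    functions occur. *)
Lemma expC_derive (z w : R[i]) (t : R) :
  is_derive t 1 (fun u => Re (expC (z + real_complex R u * w)))
    (Re (w * expC (z + real_complex R t * w))) /\
  is_derive t 1 (fun u => Im (expC (z + real_complex R u * w)))
    (Im (w * expC (z + real_complex R t * w))).
Proof.
case: z w => [a b] [c d].
have lin (p q : R) : is_derive t 1 (fun u : R => p + u * q) q.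
  have := is_deriveD (is_derive_cst p t (1 : R))
    (is_deriveM (is_derive_id t (1 : R)) (is_derive_cst q t (1 : R))).
  by move=> D; apply: (is_derive_eq D); rewrite /GRing.scale/=; ring.
have ed := is_derive1_comp (is_derive_expR _) (lin a c).
have cd := is_derive1_comp (is_derive_cos _) (lin b d).
have sd := is_derive1_comp (is_derive_sin _) (lin b d).
have reE (u : R) : Re (expC (complex.Complex a b +
      real_complex R u * complex.Complex c d)) =
    expR (a + u * c) * cos (b + u * d).
  by rewrite /expC /= !mul0r !subr0 !addr0.
have imE (u : R) : Im (expC (complex.Complex a b +
      real_complex R u * complex.Complex c d)) =
    expR (a + u * c) * sin (b + u * d).
  by rewrite /expC /= !mul0r !subr0 !addr0.
split.
  rewrite cReM reE imE; under eq_fun do rewrite reE.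
  by apply: (is_derive_eq (is_deriveM ed cd)); rewrite /GRing.scale/=; ring.
rewrite cImM reE imE; under eq_fun do rewrite imE.
by apply: (is_derive_eq (is_deriveM ed sd)); rewrite /GRing.scale/=; ring.
Qed.

(** The derivative of [P_O] at [Z] in the direction [D]. *)
Definition dPext Z D O : R[i] :=
  \sum_(S : {set 'I_n} | (#|S| == m) && (O \subset S))
     pair_sum D S * expC (pair_sum Z S).

Lemma Pext_segment_derive Z D O (t : R) :
  is_derive t 1 (fun u => Re (Pext m (segment_mx Z D u) O))
    (Re (dPext (segment_mx Z D t) D O)) /\
  is_derive t 1 (fun u => Im (Pext m (segment_mx Z D u) O))
    (Im (dPext (segment_mx Z D t) D O)).
Proof.
rewrite cRe_sum cIm_sum; split.
  under eq_fun do rewrite cRe_sum.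
  apply: is_derive_bigsum => S _; under eq_fun do rewrite pair_sumD.
  by rewrite pair_sumD; have [] := expC_derive (pair_sum Z S) (pair_sum D S) t.
under eq_fun do rewrite cIm_sum.
apply: is_derive_bigsum => S _; under eq_fun do rewrite pair_sumD.
by rewrite pair_sumD; have [] := expC_derive (pair_sum Z S) (pair_sum D S) t.
Qed.

Definition swap_mx Z i j : 'M[R[i]]_n :=
  \matrix_(a, b) Z (tperm i j a) (tperm i j b).

Lemma swap_mx_sym Z i j : Z^T = Z -> (swap_mx Z i j)^T = swap_mx Z i j.
Proof. by move=> ZT; apply/matrixP => a b; rewrite !mxE -[in LHS]ZT mxE. Qed.

(** Off the diagonal, the difference lives in the rows and columns of [i] and [j], with opposite
    entries in the two rows and 0 at [(i, j)]. If [S] contains [j] too, the two rows cancel;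
    otherwise row [i] alone remains. *)
Lemma pair_sum_swap_mx Z S i j : Z^T = Z -> i != j -> i \in S ->
  pair_sum (swap_mx Z i j - Z) S =
  \sum_(k | (k != i) && (k != j))
    (Z j k - Z i k) *+ ((k \in S) && (j \notin S)).
Proof.
move=> ZT ij iS.
have symZ a b : Z a b = Z b a by rewrite -[in LHS]ZT mxE.
set D := swap_mx Z i j - Z.
have DT : D^T = D by rewrite /D raddfB/= ZT swap_mx_sym.
have Di k : k != i -> k != j -> D i k = Z j k - Z i k.
  by move=> ki kj; rewrite !mxE tpermL tpermD// eq_sym.
have Dj k : k != i -> k != j -> D j k = - (Z j k - Z i k).
  by move=> ki kj; rewrite !mxE tpermR tpermD 1?eq_sym// opprB.
have Dij : D i j = 0 by rewrite !mxE tpermL tpermR symZ subrr.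
have D0 a b : a != i -> a != j -> b != i -> b != j -> D a b = 0.
  by move=> *; rewrite !mxE !tpermD 1?eq_sym// subrr.
rewrite -(setD1K iS) pair_sumU1// ?setD11// (setD1K iS).
have [jS|jS] := boolP (j \in S); last first.
  rewrite pair_sum_eq0 ?add0r; last first.
    move=> a b; rewrite !inE => /andP[ai aS] /andP[bi bS] _.
    by apply: D0 => //; [apply: contraNneq jS => <-|apply: contraNneq jS => <-].
  under [RHS]eq_bigr do rewrite andbT mulrb.
  rewrite -big_mkcondr/=; apply: eq_big => k; rewrite !inE.
    have [->|kj] := eqVneq k j; first by rewrite (negbTE jS) !andbF.
    by rewrite andbT.
  move=> /andP[ki kS]; apply: Di => //.
  by apply: contraNneq jS => <-.
have jSi : j \in S :\ i by rewrite !inE eq_sym ij.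
rewrite [RHS]big1 => [|k _]; last by rewrite andbF.
rewrite -(setD1K jSi) pair_sumU1// ?setD11//.
rewrite pair_sum_eq0 ?add0r; last first.
  by move=> a b; rewrite !inE => /and3P[aj ai _] /and3P[bj bi _] _; exact: D0.
rewrite big_setU1 ?setD11//= Dij add0r -big_split/=; apply: big1 => k.
by rewrite !inE => /and3P[kj ki _]; rewrite Di// Dj// addNr.
Qed.

(** The condition [k \in S], [j \notin S] is the indicator of [k \in S] minus that of both [k] and
    [j] in [S]. The direction comes from [Z], while the base point [Z'] is free to move along the
    segment. *)
Lemma dPext_swap_mx Z Z' O i j : Z^T = Z -> i != j -> i \in O ->
  dPext Z' (swap_mx Z i j - Z) O =
  \sum_(k | (k != i) && (k != j))
     (Z j k - Z i k) * (Pext m Z' (k |: O) - Pext m Z' (k |: (j |: O))).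
Proof.
move=> ZT ij iO; rewrite /dPext.
under eq_bigr => S /andP[_ /subsetP/(_ i iO) iS].
  rewrite pair_sum_swap_mx// mulr_suml; over.
rewrite exchange_big/=; apply: eq_bigr => k _.
have PE (A : {set 'I_n}) : Pext m Z' (k |: (A :|: O)) =
    \sum_(S : {set 'I_n} | (#|S| == m) && (O \subset S))
       expC (pair_sum Z' S) *+ ((k \in S) && (A \subset S)).
  under [RHS]eq_bigr do rewrite mulrb.
  rewrite -big_mkcondr/=; apply: eq_bigl => S.
  by rewrite !subUset sub1set -!andbA; do !bool_congr.
have := PE set0; rewrite set0U => ->.
have := PE [set j] => ->.
rewrite -sumrB mulr_sumr; apply: eq_bigr => S _.
by rewrite sub0set sub1set andbT; do 2!case: (_ \in S);
  rewrite /= ?mulr0n ?mulr1n ?mul0r ?subr0 ?subrr ?mulr0.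
Qed.

End Path.


(** * Geometry of a family of children [P_{O+k}] *)

Section Cones.
Variables (R : realType) (n m : nat).
Implicit Types (Z D : 'M[R[i]]_n) (S T O : {set 'I_n}) (i j k l : 'I_n).

Local Notation Re := (@complex.Re R).
Local Notation Im := (@complex.Im R).

Definition bounded_sym (al be : R) Z : Prop :=
  Z^T = Z /\ forall i j, i != j -> `|Re (Z i j)| <= al /\ `|Im (Z i j)| <= be.

(** Swapping indices preserves the bounds and they are convex conditions, so induction hypotheses
    apply along the whole segment. *)
Lemma bounded_sym_segment al be Z i j (t : R) :
  bounded_sym al be Z -> 0 <= t <= 1 ->
  bounded_sym al be (segment_mx Z (swap_mx Z i j - Z) t).
Proof.
move=> [ZT Zb] /andP[t0 t1]; split.
  by rewrite /segment_mx linearD linearZ linearB/= swap_mx_sym// ZT.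
move=> a b ab.
have sab : tperm i j a != tperm i j b by rewrite (inj_eq perm_inj).
have [h1 h2] := Zb a b ab; have [h3 h4] := Zb _ _ sab.
have conv (x y c : R) : `|x| <= c -> `|y| <= c -> `|x + t * (y - x)| <= c.
  rewrite !ler_norml => /andP[? ?] /andP[? ?]; apply/andP; split; nra.
by rewrite !mxE; split; rewrite !cReImE/= !mul0r ?subr0 ?addr0; apply: conv.
Qed.

(** The inductive property; note that [M] compares squared moduli. *)
Definition narrow_family (tau M : R) Z O : Prop :=
  forall k l, k \notin O -> l \notin O ->
    `|ccross (Pext m Z (k |: O)) (Pext m Z (l |: O))|
       <= tau * cdot (Pext m Z (k |: O)) (Pext m Z (l |: O)) /\
    cdot (Pext m Z (k |: O)) (Pext m Z (k |: O))
       <= M * cdot (Pext m Z (l |: O)) (Pext m Z (l |: O)).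

Section Family.
Variables (tau M : R) (Z : 'M[R[i]]_n) (O : {set 'I_n}).
Hypotheses (tau0 : 0 <= tau) (Om : (#|O| <= m)%N).
Hypothesis cone : narrow_family tau M Z O.

Let p := Pext m Z O.
Let u k := Pext m Z (k |: O).

(** A positive multiple of [p] is the sum of the children [u l], and the cone inequality against a
    fixed [u k] is additive in [l]. In the other cases [u k] is [p] or 0. *)
Lemma child_cone k : `|ccross p (u k)| <= tau * cdot p (u k).
Proof.
have [kO|kO] := boolP (k \in O).
  rewrite /u (setUidPr _) ?sub1set// -/p ccrossvv normr0.
  by rewrite mulr_ge0// cdotvv_ge0.
have [Om'|Om'] := ltnP #|O| m; last first.
  rewrite /u Pext_card_gt; last by rewrite cardsU1 kO.
  by rewrite /ccross /cdot/= !mulr0 subr0 normr0 addr0 mulr0.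
have c0 : 0 < (m - #|O|)%:R :> R by rewrite ltr0n subn_gt0.
have cE : (m - #|O|)%:R * p = \sum_(l | l \notin O) u l.
  by rewrite Pext_children.
have ReC : Re (m - #|O|)%:R = (m - #|O|)%:R /\ Im (m - #|O|)%:R = 0.
  by rewrite -(rmorph_nat (real_complex R)).
have dE : (m - #|O|)%:R * cdot p (u k) = \sum_(l | l \notin O) cdot (u k) (u l).
  by rewrite -cdot_sumr -cE /cdot !cReImE ReC.1 ReC.2; ring.
have xE : (m - #|O|)%:R * ccross p (u k) =
    - \sum_(l | l \notin O) ccross (u k) (u l).
  by rewrite -ccross_sumr -cE /ccross !cReImE ReC.1 ReC.2; ring.
rewrite -(ler_pM2l c0) -[X in X * _](gtr0_norm c0) -normrM xE normrN mulrCA dE.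
rewrite mulr_sumr; apply: le_trans (ler_norm_sum _ _ _) _.
by apply: ler_sum => l lO; have [] := cone kO lO.
Qed.

Lemma child_dot_ge0 k : 0 < tau -> 0 <= cdot p (u k).
Proof.
by move=> t0; rewrite -(pmulr_rge0 _ t0) (le_trans _ (child_cone k)).
Qed.

Lemma child_dot_sum :
  \sum_(k | k \notin O) cdot p (u k) = (m - #|O|)%:R * cdot p p.
Proof.
rewrite -cdot_sumr Pext_children -/p /cdot !cReImE.
by rewrite -(rmorph_nat (real_complex R))/=; ring.
Qed.

Lemma child_cross_sum : \sum_(k | k \notin O) ccross p (u k) = 0.
Proof.
rewrite -ccross_sumr Pext_children -/p /ccross !cReImE.
by rewrite -(rmorph_nat (real_complex R))/=; ring.
Qed.

(** This is [balanced_cone] in coordinates along and orthogonal to [p]: passing to them multiplies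
    both products by [|p|^2], and the orthogonal components sum to 0 because the children sum to a
    multiple of [p]. *)
Lemma child_cross_le :
  2 * \sum_(k | k \notin O) `|ccross p (u k)| <= tau * ((m - #|O|)%:R * cdot p p).
Proof.
rewrite -child_dot_sum; apply: balanced_cone => //.
- move=> k l kO lO; have [h _] := cone kO lO.
  have -> : cdot p (u k) * ccross p (u l) - ccross p (u k) * cdot p (u l) =
      cdot p p * ccross (u k) (u l) by rewrite /cdot /ccross; ring.
  have -> : cdot p (u k) * cdot p (u l) + ccross p (u k) * ccross p (u l) =
      cdot p p * cdot (u k) (u l) by rewrite /cdot /ccross; ring.
  by rewrite normrM (ger0_norm (cdotvv_ge0 _)) mulrCA ler_wpM2l// cdotvv_ge0.
- by move=> k _; exact: child_cone.
- exact: child_cross_sum.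
Qed.

(** Indices [k] in [O] other than [i] give [u k = p], at most [|O| - 1] times; the others are
    children, and adding missing terms only increases the bound. *)
Lemma sum_children_le (F : R[i] -> R) i j : i \in O -> (forall v, 0 <= F v) ->
  \sum_(k | (k != i) && (k != j)) F (u k) <=
  #|O|.-1%:R * F p + \sum_(k | k \notin O) F (u k).
Proof.
move=> iO F0; rewrite (bigID (mem O))/=; apply: lerD.
  have -> : #|O|.-1%:R * F p = \sum_(k in O :\ i) F p.
    by rewrite sumr_const mulr_natl cardsDS ?sub1set// cards1 subn1.
  rewrite [leRHS](bigID (fun k => k == j))/= -[leLHS]add0r; apply: lerD.
    by apply: sumr_ge0.
  rewrite le_eqVlt; apply/orP; left; apply/eqP; apply: eq_big => k.
    by rewrite !inE -!andbA; do !bool_congr.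
  by move=> /andP[_ kO]; rewrite /u (setUidPr _) ?sub1set.
rewrite [leRHS](bigID (fun k => (k != i) && (k != j)))/= -[leLHS]addr0.
apply: lerD; last exact: sumr_ge0.
by rewrite le_eqVlt; apply/orP; left; apply/eqP; apply: eq_bigl => k; rewrite andbC.
Qed.

(** The [|O| - 1] copies of [p] and the weight [m - |O|] of the children add up to [m - 1], which
    later cancels the denominator in the bounds on [Z]. *)
Lemma sum_cdot_le i j : 0 < tau -> i \in O ->
  \sum_(k | (k != i) && (k != j)) `|cdot p (u k)| <= (m - 1)%:R * cdot p p.
Proof.
move=> t0 iO.
apply: le_trans (sum_children_le (F := fun v => `|cdot p v|) j iO _) _;
  first by [].
rewrite (ger0_norm (cdotvv_ge0 _)).
under eq_bigr do rewrite ger0_norm ?child_dot_ge0//.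
rewrite child_dot_sum -mulrDl -natrD ler_wpM2r ?cdotvv_ge0// ler_nat.
have : (0 < #|O|)%N by apply/card_gt0P; exists i.
by lia.
Qed.

Lemma sum_ccross_le i j : i \in O ->
  2 * \sum_(k | (k != i) && (k != j)) `|ccross p (u k)|
    <= tau * ((m - 1)%:R * cdot p p).
Proof.
move=> iO.
have := sum_children_le (F := fun v => `|ccross p v|) j iO (fun=> normr_ge0 _).
rewrite ccrossvv normr0 mulr0 add0r => h.
rewrite -(ler_pM2l (_ : 0 < 2 :> R))// in h.
apply: le_trans h _; apply: le_trans child_cross_le _.
rewrite ler_wpM2l// ler_wpM2r ?cdotvv_ge0// ler_nat.
have : (0 < #|O|)%N by apply/card_gt0P; exists i.
by lia.
Qed.

(** Some child exists as [|O| < n]. If [p] were 0, the dot products of one child with all children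
    would sum to 0; but all are nonnegative and the one with itself is positive. *)
Lemma family_nonzero : (#|O| < m)%N -> (m <= n)%N ->
  (forall k, k \notin O -> u k != 0) -> 0 < tau -> p != 0.
Proof.
move=> Om' mn u0 t0; apply/eqP => p0.
have [k kO] : exists k, k \notin O.
  apply/existsP; rewrite -negb_forall; apply/forallP => /= OT.
  have OE : #|O| = n.
    rewrite -[RHS]card_ord -cardsT; congr #|pred_of_set _|.
    by apply/setP => k; rewrite inE OT.
  by rewrite OE ltnNge mn in Om'.
have := cdot_sumr (index_enum 'I_n) (fun k => k \notin O) u (u k).
rewrite Pext_children -/p p0 mulr0 {1}/cdot/= !mulr0 addr0 (bigD1 k)//= => /esym/eqP.
rewrite paddr_eq0 ?cdotvv_ge0//; last first.
  apply: sumr_ge0 => l /andP[lO _]; have [h _] := cone kO lO.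
  by rewrite -(pmulr_rge0 _ t0) (le_trans _ h).
by rewrite cdotvv_eq0 (negbTE (u0 k kO)).
Qed.

End Family.

End Cones.


(** Resolve [p] and [v] along [q] and orthogonally to it: the tangents at most add up, whence
    [2 * tau]. It bounds a grandchild [v] relative to [p] through the child [q]. *)
Lemma cone_trans (R : realType) (tau : R) (p q v : R[i]) : 0 < tau <= 1 ->
  q != 0 -> `|ccross p q| <= tau * cdot p q -> `|ccross q v| <= tau * cdot q v ->
  `|ccross p v| <= 2 * tau * (cdot p q / cdot q q) * cdot q v /\
  `|cdot p v| <= 2 * (cdot p q / cdot q q) * cdot q v.
Proof.
move=> /andP[t0 t1]; rewrite -cdotvv_gt0 => q0 pq qv.
have xE : cdot q q * ccross p v = ccross p q * cdot q v + cdot p q * ccross q v.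
  by rewrite /cdot /ccross; ring.
have dE : cdot q q * cdot p v = cdot p q * cdot q v - ccross p q * ccross q v.
  by rewrite /cdot /ccross; ring.
have pq0 : 0 <= cdot p q by rewrite -(pmulr_rge0 _ t0) (le_trans _ pq).
have qv0 : 0 <= cdot q v by rewrite -(pmulr_rge0 _ t0) (le_trans _ qv).
have cE (c : R) : c * (cdot p q / cdot q q) * cdot q v =
    c * (cdot p q * cdot q v) / cdot q q by field; rewrite gt_eqF.
rewrite !cE !ler_pdivlMr// -[X in _ * X](gtr0_norm q0).
rewrite -[X in _ /\ _ * X <= _](gtr0_norm q0) -!normrM.
rewrite [ccross p v * _]mulrC [cdot p v * _]mulrC xE dE; split.
  apply: le_trans (ler_normD _ _) _; rewrite !normrM.
  rewrite (ger0_norm qv0) (ger0_norm pq0).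
  have := ler_wpM2r qv0 pq; have := ler_wpM2l pq0 qv; lra.
apply: le_trans (ler_normB _ _) _; rewrite !normrM.
rewrite (ger0_norm qv0) (ger0_norm pq0).
have pq1 : `|ccross p q| <= cdot p q by apply: le_trans pq _; rewrite ler_piMl.
have qv1 : `|ccross q v| <= cdot q v by apply: le_trans qv _; rewrite ler_piMl.
have := ler_pM (normr_ge0 _) (normr_ge0 _) pq1 qv1; lra.
Qed.

(** * Speed of [P_O] along the segment, where [O] contains [i] but not [j] *)

Section Step.
Variables (R : realType) (n m : nat).
Implicit Types (Z D : 'M[R[i]]_n) (S T O : {set 'I_n}) (i j k l : 'I_n).

Local Notation Re := (@complex.Re R).
Local Notation Im := (@complex.Im R).

Section Estimate.
Variables (tau M K ep : R) (Z : 'M[R[i]]_n) (O : {set 'I_n}) (i j : 'I_n).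
Hypotheses (tau01 : 0 < tau <= 1) (ep0 : 0 < ep) (K1 : 0 < K).
Hypotheses (KM : 2 * M <= K ^+ 2) (M0 : 0 <= M).
Hypotheses (iO : i \in O) (jO : j \notin O).
Hypotheses (Om : (#|O| <= m)%N) (cone : narrow_family m tau M Z O).
Hypothesis (nm : K / ep * (m - #|O|)%:R <= (n - #|O|)%:R).

Let p := Pext m Z O.
Let u k := Pext m Z (k |: O).

Let tau0 : 0 < tau. Proof. by case/andP: tau01. Qed.
Let tau0' : 0 <= tau. Proof. exact: ltW. Qed.
Let tau1 : tau <= 1. Proof. by case/andP: tau01. Qed.

(** The square of [cdot p (u j)] is at most [|p|^2 |u j|^2], hence at most [M |p|^2 |u k|^2]. As
    [u k] makes an angle of tangent at most 1 with [p], this is at most [2 * M] times the square of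
    [cdot p (u k)]. *)
Lemma child_dot_comparable k : k \notin O -> cdot p (u j) <= K * cdot p (u k).
Proof.
move=> kO.
have xj0 : 0 <= cdot p (u j) by exact: child_dot_ge0 tau0' cone _ tau0.
have xk0 : 0 <= cdot p (u k) by exact: child_dot_ge0 tau0' cone _ tau0.
have Kx : 0 <= K * cdot p (u k) by rewrite mulr_ge0// ltW.
rewrite -(ler_sqr (_ : _ \is Num.nneg)) ?nnegrE// exprMn.
have nE v : cdot p v ^+ 2 + ccross p v ^+ 2 = cdot p p * cdot v v.
  by rewrite /cdot /ccross; ring.
have [_ jk] := cone jO kO.
have h1 : cdot p (u j) ^+ 2 <= cdot p p * (M * cdot (u k) (u k)).
  apply: (@le_trans _ _ (cdot p p * cdot (u j) (u j))).
    by rewrite -nE lerDl sqr_ge0.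
  by rewrite ler_wpM2l ?cdotvv_ge0.
apply: le_trans h1 _; rewrite mulrCA -nE.
have hk : `|ccross p (u k)| <= cdot p (u k).
  by apply: le_trans (child_cone tau0' cone k) _; rewrite ler_piMl.
have : ccross p (u k) ^+ 2 <= cdot p (u k) ^+ 2.
  by rewrite -[leLHS]real_normK ?num_real// ler_sqr ?nnegrE.
move=> h2; apply: (@le_trans _ _ (M * (2 * cdot p (u k) ^+ 2))).
  by rewrite ler_wpM2l//; lra.
by rewrite mulrCA mulrA ler_wpM2r// sqr_ge0.
Qed.

(** Average [child_dot_comparable] over the [n - |O|] indices [k]: the right sides sum to
    [K (m - |O|) |p|^2]. Here the largeness of [n / m] enters. *)
Lemma child_dot_small : cdot p (u j) <= ep * cdot p p.
Proof.
have N0 : 0 < (n - #|O|)%:R :> R.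
  rewrite ltr0n subn_gt0 -[X in (_ < X)%N]card_ord -cardsT proper_card//.
  by rewrite properT; apply: contraNneq jO => ->; rewrite inE.
rewrite -(ler_pM2l N0).
have -> : (n - #|O|)%:R * cdot p (u j) = \sum_(k | k \notin O) cdot p (u j).
  rewrite sumr_const mulr_natl; congr (_ *+ _).
  by rewrite -[X in (X - _)%N]card_ord -(cardC (mem O)) addKn.
apply: (@le_trans _ _ (K * ((m - #|O|)%:R * cdot p p))).
  rewrite -child_dot_sum mulr_sumr; apply: ler_sum => k kO.
  exact: child_dot_comparable.
rewrite mulrA [leRHS]mulrA; apply: ler_wpM2r; first exact: cdotvv_ge0.
rewrite -ler_pdivrMr//; apply: le_trans nm.
by rewrite mulrAC.
Qed.

Hypothesis cone2 : narrow_family m tau M Z (j |: O).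
Hypothesis q0 : (#|O| < m)%N -> u j != 0.
Let v k := Pext m Z (k |: (j |: O)).

(** Apply [cone_trans] through [q = u j] and sum: the dot products of [u j] with the [v k] total at
    most [(m - 1) |u j|^2], which cancels the denominator. If [|O| = m], every [v k] is 0. *)
Lemma sum_grandchild_le :
  \sum_(k | (k != i) && (k != j)) `|ccross p (v k)|
     <= 2 * tau * (m - 1)%:R * cdot p (u j) /\
  \sum_(k | (k != i) && (k != j)) `|cdot p (v k)|
     <= 2 * (m - 1)%:R * cdot p (u j).
Proof.
have cO : #|j |: O| = #|O|.+1 by rewrite cardsU1 jO.
have pq := child_cone tau0' cone j.
have pq0 : 0 <= cdot p (u j) by exact: child_dot_ge0 tau0' cone _ tau0.
have [Om'|Om'] := ltnP #|O| m; last first.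
  have v0 k : v k = 0.
    rewrite /v Pext_card_gt//; apply: leq_trans (subset_leq_card (subsetUr _ _)).
    by rewrite cO ltnS.
  split; rewrite big1 => [|k _]; rewrite ?mulr_ge0//.
    by rewrite v0 /ccross/= !mulr0 subr0 normr0.
  by rewrite v0 /cdot/= !mulr0 addr0 normr0.
have Om2 : (#|j |: O| <= m)%N by rewrite cO.
have iO2 : i \in j |: O by rewrite !inE iO orbT.
have qv k := child_cone tau0' cone2 k.
have ct k := cone_trans tau01 (q0 Om') pq (qv k).
have vS := sum_cdot_le tau0' Om2 cone2 j tau0 iO2.
have qq : 0 < cdot (u j) (u j) by rewrite cdotvv_gt0 q0.
have {}vS : \sum_(k | (k != i) && (k != j)) cdot (u j) (v k) <=
    (m - 1)%:R * cdot (u j) (u j).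
  by apply: le_trans vS; apply: ler_sum => k _; exact: ler_norm.
have fin (c : R) : 0 <= c ->
    c * (cdot p (u j) / cdot (u j) (u j)) *
      \sum_(k | (k != i) && (k != j)) cdot (u j) (v k)
    <= c * (m - 1)%:R * cdot p (u j).
  move=> c0.
  apply: le_trans (ler_wpM2l _ vS) _.
    by rewrite mulr_ge0// divr_ge0// ltW.
  by rewrite le_eqVlt; apply/orP; left; apply/eqP; field; rewrite gt_eqF.
split.
  apply: le_trans (fin (2 * tau) _); last by rewrite mulr_ge0.
  by rewrite mulr_sumr; apply: ler_sum => k _; have [] := ct k.
apply: le_trans (fin 2 _) => //.
by rewrite mulr_sumr; apply: ler_sum => k _; have [] := ct k.
Qed.

Variables (a b : R) (d : 'I_n -> R[i]).
Hypotheses (a0 : 0 <= a) (b0 : 0 <= b).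
Hypothesis db : forall k, k != i -> k != j ->
  `|Re (d k)| <= a /\ `|Im (d k)| <= b.

Let G := \sum_(k | (k != i) && (k != j)) d k * (u k - v k).

(** The terms without [ep] come from the children [u k], the half of [tau] being the gain of
    [balanced_cone]; the terms with [ep] come from the grandchildren [v k], small by
    [child_dot_small]. *)
Lemma velocity_le :
  `|ccross p G| <= (a * (tau / 2) + b + ep * (2 * a * tau + 2 * b)) *
                     ((m - 1)%:R * cdot p p) /\
  `|cdot p G| <= (a + b * (tau / 2) + ep * (2 * a + 2 * b * tau)) *
                     ((m - 1)%:R * cdot p p).
Proof.
have -> : G = \sum_(k | (k != i) && (k != j)) d k * u k -
              \sum_(k | (k != i) && (k != j)) d k * v k.
  by rewrite -sumrB; apply: eq_bigr => k _; rewrite mulrBr.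
set G1 := \sum_(k | _) d k * u k; set G2 := \sum_(k | _) d k * v k.
have xB : ccross p (G1 - G2) = ccross p G1 - ccross p G2.
  by rewrite /ccross !cReImE; ring.
have dB : cdot p (G1 - G2) = cdot p G1 - cdot p G2.
  by rewrite /cdot !cReImE; ring.
have da k : (k != i) && (k != j) -> `|Re (d k)| <= a.
  by move=> /andP[ki kj]; have [] := db ki kj.
have db' k : (k != i) && (k != j) -> `|Im (d k)| <= b.
  by move=> /andP[ki kj]; have [] := db ki kj.
have x1 := weighted_ccross_le u p da db'.
have d1 := weighted_cdot_le u p da db'.
have x2 := weighted_ccross_le v p da db'.
have d2 := weighted_cdot_le v p da db'.
have [vx vd] := sum_grandchild_le.
have ux := sum_ccross_le tau0' Om cone j iO.
have ud := sum_cdot_le tau0' Om cone j tau0 iO.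
have sm := child_dot_small.
rewrite -/p -/u -/v in x1 d1 x2 d2 vx vd ux ud sm.
set X := \sum_(k | _) `|ccross p (u k)| in x1 d1 ux.
set Y := \sum_(k | _) `|cdot p (u k)| in x1 d1 ud.
set X' := \sum_(k | _) `|ccross p (v k)| in x2 d2 vx.
set Y' := \sum_(k | _) `|cdot p (v k)| in x2 d2 vd.
set N := (m - 1)%:R in vx vd ux ud *.
set P := cdot p p in ux ud sm *.
have N0 : 0 <= N by rewrite /N.
have sm' := ler_wpM2l N0 sm.
have vx' : X' <= 2 * tau * (ep * (N * P)).
  apply: le_trans vx _; rewrite -!mulrA ler_pM2l// ler_pM2l//.
  by rewrite [leRHS]mulrCA.
have vd' : Y' <= 2 * (ep * (N * P)).
  by apply: le_trans vd _; rewrite -mulrA ler_pM2l// [leRHS]mulrCA.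
have ux' : X <= tau / 2 * (N * P) by lra.
have := ler_wpM2l a0 ux'; have := ler_wpM2l b0 ux'.
have := ler_wpM2l a0 ud; have := ler_wpM2l b0 ud.
have := ler_wpM2l a0 vx'; have := ler_wpM2l b0 vx'.
have := ler_wpM2l a0 vd'; have := ler_wpM2l b0 vd'.
move=> h1 h2 h3 h4 h5 h6 h7 h8.
rewrite xB dB; split; apply: le_trans (ler_normB _ _) _.
  by apply: le_trans (lerD x1 x2) _; lra.
by apply: le_trans (lerD d1 d2) _; lra.
Qed.

End Estimate.

End Step.


(** * Descending induction on the size of [O] *)

Section Descent.
Variables (R : realType) (n m : nat).
Implicit Types (Z D : 'M[R[i]]_n) (S T O : {set 'I_n}) (i j k l : 'I_n).
Variables (al be tau C K ep : R).
Hypotheses (tau01 : 0 < tau <= 1) (ep0 : 0 < ep) (K1 : 0 < K) (C0 : 0 <= C).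
Hypotheses (al0 : 0 <= al) (be0 : 0 <= be).
Hypotheses (KC : 2 * expR (2 * C) <= K ^+ 2) (mn : (m <= n)%N).
Hypotheses (Kep : 1 <= K / ep) (nm : K / ep * m%:R <= n%:R).
Hypothesis angle_speed :
  (2 * al * (tau / 2) + 2 * be + ep * (2 * (2 * al) * tau + 2 * (2 * be)))
    * (m - 1)%:R <= atan tau.
Hypothesis modulus_speed :
  (2 * al + 2 * be * (tau / 2) + ep * (2 * (2 * al) + 2 * (2 * be) * tau))
    * (m - 1)%:R <= C.

(** All matrices within the bounds are treated together, since the induction step moves [Z]. *)
Definition narrow_at s : Prop := forall Z O, bounded_sym al be Z -> #|O| = s ->
  narrow_family m tau (expR (2 * C)) Z O.

Definition nonzero_at s : Prop := forall Z O, bounded_sym al be Z -> #|O| = s ->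
  Pext m Z O != 0.

(** Follow [f t], the sum for [i |: O], from [Z] to the swapped matrix, where it equals the sum for
    [j |: O]. The hypotheses on speed are the bounds of [velocity_le] with [a = 2 * al],
    [b = 2 * be], as each [Z j k - Z i k] is a difference of two entries. *)
Lemma narrow_step s : (s < m)%N -> narrow_at s.+1 -> nonzero_at s.+1 ->
  narrow_at s.+2 -> ((s.+1 < m)%N -> nonzero_at s.+2) -> narrow_at s.
Proof.
move=> sm cone1 nz1 cone2 nz2 Z O Zb Os.
have tau0 : 0 <= tau by case/andP: tau01 => /ltW.
have M0 : 0 <= expR (2 * C) by exact: expR_ge0.
suff main i j : i != j -> i \notin O -> j \notin O ->
    `|ccross (Pext m Z (i |: O)) (Pext m Z (j |: O))|
       <= tau * cdot (Pext m Z (i |: O)) (Pext m Z (j |: O)) /\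
    cdot (Pext m Z (j |: O)) (Pext m Z (j |: O))
       <= expR (2 * C) * cdot (Pext m Z (i |: O)) (Pext m Z (i |: O)).
  move=> k l kO lO; have [->|kl] := eqVneq k l.
    rewrite ccrossvv normr0 mulr_ge0 ?cdotvv_ge0//; split=> //.
    by rewrite ler_peMl ?cdotvv_ge0// (le_trans _ (expR_ge1Dx _)) ?lerDl ?mulr_ge0.
  have lk : l != k by rewrite eq_sym.
  by split; [case: (main k l kl kO lO)|case: (main l k lk lO kO)].
move=> ij iO jO.
have [ZT Zd] := Zb.
pose D := swap_mx Z i j - Z.
pose f t := Pext m (segment_mx Z D t) (i |: O).
have f0 : Pext m (segment_mx Z D 0) (i |: O) = Pext m Z (i |: O).
  by rewrite /segment_mx rmorph0 scale0r addr0.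
have f1 : Pext m (segment_mx Z D 1) (i |: O) = Pext m Z (j |: O).
  by rewrite /segment_mx rmorph1 scale1r addrC subrK Pext_perm.
have cO : #|i |: O| = s.+1 by rewrite cardsU1 iO Os.
have jiO : j \notin i |: O by rewrite !inE negb_or eq_sym ij.
have fnz t : 0 <= t <= 1 -> f t != 0.
  by move=> t01; apply: nz1 => //; exact: bounded_sym_segment.
have vel t : 0 <= t <= 1 ->
    `|ccross (f t) (dPext m (segment_mx Z D t) D (i |: O))|
       <= atan tau * cdot (f t) (f t) /\
    `|cdot (f t) (dPext m (segment_mx Z D t) D (i |: O))| <= C * cdot (f t) (f t).
  move=> t01; have Ztb := bounded_sym_segment i j Zb t01.
  rewrite dPext_swap_mx ?setU11//.
  have db k : k != i -> k != j -> `|complex.Re (Z j k - Z i k)| <= 2 * al /\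
      `|complex.Im (Z j k - Z i k)| <= 2 * be.
    move=> ki kj; rewrite !cReImE.
    have [h1 h2] := Zd j k (contra_neq (@esym _ _ _) kj).
    have [h3 h4] := Zd i k (contra_neq (@esym _ _ _) ki).
    by split; (apply: le_trans (ler_normB _ _) _; lra).
  (* Decreasing [m] and [n] by the same amount preserves the inequality because [K / ep >= 1]. *)
  have nm' : K / ep * (m - #|i |: O|)%:R <= (n - #|i |: O|)%:R.
    rewrite cO !natrB ?(leq_trans sm)// mulrBr lerB// ler_peMl//.
  have cOm : (#|i |: O| <= m)%N by rewrite cO.
  have q0 : (#|i |: O| < m)%N -> Pext m (segment_mx Z D t) (j |: (i |: O)) != 0.
    by rewrite cO => /nz2; apply=> //; rewrite cardsU1 jiO cO.
  have c1 : narrow_family m tau (expR (2 * C)) (segment_mx Z D t) (i |: O).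
    exact: cone1.
  have c2 : narrow_family m tau (expR (2 * C)) (segment_mx Z D t) (j |: (i |: O)).
    by apply: cone2 => //; rewrite cardsU1 jiO cO.
  have a20 : 0 <= 2 * al by rewrite mulr_ge0.
  have b20 : 0 <= 2 * be by rewrite mulr_ge0.
  have [vx vd] := velocity_le tau01 ep0 K1 KC M0 (setU11 _ _) jiO cOm
    c1 nm' c2 q0 a20 b20 db.
  split.
    by apply: le_trans vx _; rewrite mulrA ler_wpM2r ?cdotvv_ge0.
  by apply: le_trans vd _; rewrite mulrA ler_wpM2r ?cdotvv_ge0.
have fR (t : R) := (Pext_segment_derive m Z D (i |: O) t).1.
have fI (t : R) := (Pext_segment_derive m Z D (i |: O) t).2.
have f_gt0 t : 0 <= t <= 1 ->
    0 < complex.Re (f t) ^+ 2 + complex.Im (f t) ^+ 2.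
  by move=> t01; rewrite !expr2 -/(cdot (f t) (f t)) cdotvv_gt0 fnz.
have ang t : 0 <= t <= 1 -> `|ccross (f t) (dPext m (segment_mx Z D t) D (i |: O))|
    <= atan tau * (complex.Re (f t) ^+ 2 + complex.Im (f t) ^+ 2).
  by move=> t01; rewrite !expr2; have [] := vel t t01.
have mod_ t : 0 <= t <= 1 -> `|cdot (f t) (dPext m (segment_mx Z D t) D (i |: O))|
    <= C * (complex.Re (f t) ^+ 2 + complex.Im (f t) ^+ 2).
  by move=> t01; rewrite !expr2; have [] := vel t t01.
rewrite -f1 -f0; split; first exact: (angle_bound fR fI tau0 f_gt0 ang).
exact: (modulus_growth fR fI mod_).
Qed.

(** Induction on [m - s], with two preceding levels available. At level [m] the sum is a single
    exponential and all children vanish. *)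
Lemma descent s : (s <= m)%N -> narrow_at s /\ nonzero_at s.
Proof.
have tau0 : 0 < tau by case/andP: tau01.
have big_narrow r : (m <= r)%N -> narrow_at r.
  move=> mr Z O _ Or k l kO lO.
  rewrite !Pext_card_gt ?cardsU1 ?kO ?lO ?Or//.
  by rewrite /ccross /cdot/= !mulr0 subr0 addr0 normr0 !mulr0.
have at_m : nonzero_at m by move=> Z O _ Om; rewrite Pext_card_eq// expC_neq0.
suff H r : (r <= m)%N -> narrow_at (m - r) /\ nonzero_at (m - r).
  by move=> sm; have := H _ (leq_subr s m); rewrite subKn.
elim/ltn_ind: r => -[_ _|r IH rm].
  by rewrite subn0; split=> //; exact: big_narrow.
have [c1 n1] := IH r (ltnSn r) (ltnW rm).
have rE : (m - r)%N = (m - r.+1).+1 by rewrite subnS prednK// subn_gt0.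
rewrite rE in c1 n1.
have [c2 n2] : narrow_at (m - r.+1).+2 /\
    (((m - r.+1).+1 < m)%N -> nonzero_at (m - r.+1).+2).
  case: r IH rm c1 n1 rE => [|r] IH rm c1 n1 rE.
    split; first by apply: big_narrow; clear; lia.
    by move=> lt1m; exfalso; clear -lt1m rm; lia.
  have [|c nz] := IH r (leqnSn r.+1); first by clear -rm; lia.
  by have -> : (m - r.+2).+2 = (m - r)%N by clear -rm; lia.
have sm : (m - r.+1 < m)%N by clear -rm; lia.
have cone := narrow_step sm c1 n1 c2 n2.
split=> // Z O Zb Os.
apply: (family_nonzero (cone Z O Zb Os)) => //; rewrite ?Os//.
by move=> k kO; apply: n1 => //; rewrite cardsU1 kO Os.
Qed.

End Descent.

(** * Choice of the constants *)

Theorem theorem1p3 (R : realType) (delta : R) (hdelta : 0 < delta < 1) :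
  exists eta omega : R,
    [/\ 0 < eta, 1 < omega &
      forall n m : nat,
        (2 <= m)%N -> (m <= n)%N -> omega * m%:R <= n%:R ->
        forall Z : 'M[R[i]]_n,
          Z^T = Z ->
          (forall i j : 'I_n, i != j ->
             `|complex.Re (Z i j)| <= delta / (m%:R - 1) /\
             `|complex.Im (Z i j)| <= eta / (m%:R - 1)) ->
          Pm m Z <> 0].
Proof.
have [d0 d1] := andP hdelta.
(* With [delta = 1 - 2 * tau], the main turning [delta * tau] falls short of [tau] by [2 * tau^2].
   Taking [eta] of order [tau^2] and [ep] of order [tau] makes the errors fit in this margin. *)
pose tau := (1 - delta) / 2; pose eta := tau ^+ 2 / 8; pose ep := tau / 10.
(* Here 12 serves as [C], a generous bound on the radial speed, and [K^2 = 4 * expR 24] exceeds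
   [2 * expR (2 * C)]. *)
pose K : R := 2 * expR 12; pose omega := K / ep.
have t0 : 0 < tau by rewrite /tau; lra.
have t1 : tau <= 1 / 2 by rewrite /tau; lra.
have tau01 : 0 < tau <= 1 by apply/andP; split; lra.
have dE : delta = 1 - 2 * tau by rewrite /tau; lra.
have eta0 : 0 < eta by rewrite divr_gt0// exprn_gt0.
have ep0 : 0 < ep by rewrite divr_gt0.
have K2 : 2 <= K.
  by rewrite ler_peMr// (le_trans _ (expR_ge1Dx _)) ?lerDl.
have om1 : 1 < omega by rewrite ltr_pdivlMr// /ep; lra.
exists eta, omega; split=> // n m m2 mn nm Z ZT Zb.
have N0 : 0 < m%:R - 1 :> R by rewrite subr_gt0 ltr1n.
have NE : (m - 1)%:R = m%:R - 1 :> R by rewrite natrB// (leq_trans _ m2).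
have t3 : 0 <= tau ^+ 2 * (1 / 2 - tau) by rewrite mulr_ge0 ?sqr_ge0//; lra.
have t2 : tau ^+ 2 <= 1 / 4.
  by rewrite (_ : 1 / 4 = (1 / 2) ^+ 2); [rewrite ler_sqr ?nnegrE; lra|field].
have [] := @descent R n m (delta / (m%:R - 1)) (eta / (m%:R - 1)) tau 12 K ep
  tau01 ep0 _ _ _ _ _ mn (ltW om1) nm _ _ 0 (leq0n m) => //.
- by lra.
- by rewrite divr_ge0// ltW.
- by rewrite divr_ge0// ltW.
- rewrite /K exprMn -expRM_natl; have := expR_gt0 (2 * 12 : R); lra.
- rewrite NE; apply: le_trans (atan_ge_div (ltW t0)).
  have D0 : 0 < 1 + tau ^+ 2 by rewrite ltr_pwDl ?sqr_ge0.
  (* [tau - tau^3] is a polynomial lower bound for [tau / (1 + tau^2)], leaving a polynomial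
     inequality in [tau]. *)
  apply: (@le_trans _ _ (tau - tau ^+ 3)); last first.
    rewrite ler_pdivlMr// -subr_ge0.
    have -> : tau - (tau - tau ^+ 3) * (1 + tau ^+ 2) = tau ^+ 5 by ring.
    by rewrite exprn_ge0// ltW.
  rewrite [leLHS](_ : _ = delta * tau + 2 * eta
      + ep * (4 * delta * tau + 4 * eta)); last by field; rewrite gt_eqF.
  by rewrite dE /eta /ep; have := sqr_ge0 tau; nra.
- rewrite NE [leLHS](_ : _ = 2 * delta + eta * tau
      + ep * (4 * delta + 4 * eta * tau)); last by field; rewrite gt_eqF.
  have e1 : eta <= 1 by rewrite /eta; lra.
  have et : eta * tau <= 1 by rewrite mulr_ile1//; lra.
  have : ep * (4 * delta + 4 * eta * tau) <= 1 * 8.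
    by apply: ler_pM; rewrite ?addr_ge0 ?mulr_ge0 ?(ltW eta0)//; rewrite /ep; lra.
  lra.
move=> _ nz; apply/eqP; rewrite -Pext0; apply: nz; last by rewrite cards0.
by split.
Qed.
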